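(* There exists a $\mathbb{Z}^2$-shift of finite type $X$ which has zero-dimensional topologically completely positive entropy (ZTCPE) but does not have topologically completely positive entropy (TCPE).
   Context: A $\mathbb{Z}^2$ topological dynamical system $(X,T_v)$ is a compact metric space $X$ with a $\mathbb{Z}^2$-action $\{T_v\}_{v\in\mathbb{Z}^2}$ by homeomorphisms of $X$. For a finite set $A$ (an alphabet), $A^{\mathbb{Z}^2}$ carries the product of discrete topologies and the shift action $(\sigma_t x)(s)=x(s+t)$, $s,t\in\mathbb{Z}^2$. A $\mathbb{Z}^2$-subshift is a nonempty closed shift-invariant subset of some $A^{\mathbb{Z}^2}$, regarded as a topological dynamical system under $\sigma$. A pattern over $A$ is an element of $A^S$ for a finite $S\subset\mathbb{Z}^2$; patterns are identified up to translation. A $\mathbb{Z}^2$-shift of finite type (SFT) is a (nonempty) subshift consisting of all $x\in A^{\mathbb{Z}^2}$ in which no pattern from some fixed finite set of patterns appears. The topological entropy is $h(X,T_v)=\sup_{\mathcal{U}}\lim_{n\to\infty}\frac1{n^2}\log N\left(\bigvee_{v\in\{1,\ldots,n\}^2} T_v\mathcal{U}\right)$, where $\mathcal{U}$ ranges over open covers of $X$ and $N(\cdot)$ is the minimal cardinality of a subcover. A factor map $(X,T_v)\to(Y,S_v)$ is a continuous map $\phi:X\to Y$ with $\phi\circ T_v=S_v\circ\phi$ for all $v\in\mathbb{Z}^2$. $(X,T_v)$ has TCPE if for every surjective factor map from $(X,T_v)$ to a $\mathbb{Z}^2$ topological dynamical system $(Y,S_v)$, either $h(Y,S_v)>0$ or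 $|Y|=1$. $(X,T_v)$ has ZTCPE if for every surjective factor map from $(X,T_v)$ to a $\mathbb{Z}^2$ topological dynamical system $(Y,S_v)$ with $Y$ zero-dimensional (i.e. having a basis of clopen sets), either $h(Y,S_v)>0$ or $|Y|=1$. *)

(* Defs.v *)
From HB Require Import structures.
From mathcomp Require Import all_boot all_order all_algebra.
From mathcomp Require Import finmap.
From mathcomp Require Import all_classical all_reals all_analysis.

Set Implicit Arguments.
Unset Strict Implicit.
Unset Printing Implicit Defensive.

Import Order.TTheory GRing.Theory Num.Theory.
Import numFieldNormedType.Exports.
Local Open Scope classical_set_scope.
Local Open Scope ring_scope.

(* A Hausdorff pseudometric space (a [pseudoMetricType] only carries a family
   of balls) is a metric space, with the same topology and uniformity: the
   distance is the truncated infimum of the radii. *)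
Section metrized.
Context {R : realType} {T : pseudoMetricType R}.

Definition radii (x y : T) : set R :=
  [set e | 0 < e /\ (1 <= e \/ ball x e y)].

Definition ball_dist (x y : T) : R := inf (radii x y).

Definition metrized (hT : hausdorff_space T) : Type := T.

Variable hT : hausdorff_space T.

Lemma radii1 x y : radii x y 1.
Proof. by split => //; left. Qed.

Lemma radii_has_inf x y : has_inf (radii x y).
Proof.
by split; [exists 1; exact: radii1|exists 0 => e [/ltW]].
Qed.

Lemma ball_dist_ge0 x y : 0 <= ball_dist x y.
Proof.
by apply: lb_le_inf; [exists 1; exact: radii1|move=> e [/ltW]].
Qed.

Lemma ball_dist_ltP x y e : ball_dist x y < e <-> exists2 r, radii x y r & r < e.
Proof.
split; first exact: inf_lt (radii_has_inf x y).1.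
move=> [r xyr re]; apply: le_lt_trans re.
by apply: ge_inf xyr; case: (radii_has_inf x y).
Qed.

Lemma ball_dist_ball x y e : ball_dist x y < e -> e <= 1 -> ball x e y.
Proof.
move=> /ball_dist_ltP[r [r0 [r1|xy]] re] e1.
  by have := lt_le_trans re e1; rewrite ltNge r1.
exact: le_ball (ltW re) _ xy.
Qed.

Lemma ball_distxx x : ball_dist x x = 0.
Proof.
apply/eqP; rewrite eq_le ball_dist_ge0 andbT; apply/ler_addgt0Pl => e e0.
rewrite addr0; apply: ge_inf; first by case: (radii_has_inf x x).
by split => //; right; exact: ballxx.
Qed.

Lemma ball_dist_sym x y : ball_dist x y = ball_dist y x.
Proof.
suff h u v : radii u v `<=` radii v u by congr inf; apply/seteqP.
by move=> e [e0 [e1|/ball_sym uv]]; split => //; [left|right].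
Qed.

Lemma ball_dist_triangle y x z :
  ball_dist x z <= ball_dist x y + ball_dist y z.
Proof.
apply/ler_addgt0Pl => e e0; apply: ltW.
have e20 : 0 < e / 2 by rewrite divr_gt0.
have /ball_dist_ltP[r [r0 xyr] re] : ball_dist x y < ball_dist x y + e / 2.
  by rewrite ltrDl.
have /ball_dist_ltP[s [s0 yzs] se] : ball_dist y z < ball_dist y z + e / 2.
  by rewrite ltrDl.
apply/ball_dist_ltP; exists (r + s); last first.
  by rewrite [e in ltRHS]splitr [ltRHS]addrC addrACA ltrD.
split; first exact: addr_gt0.
case: xyr => [r1|xyr]; first by left; rewrite (le_trans r1)// lerDl ltW.
case: yzs => [s1|yzs]; first by left; rewrite (le_trans s1)// lerDr ltW.
by right; exact: ball_triangle xyr yzs.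
Qed.

Lemma ball_dist_entourageE :
  entourage = entourage_ (fun x e => [set y : T | ball_dist x y < e]).
Proof.
rewrite -entourage_ballE; apply/seteqP; split=> E [e /= e0 eE].
- exists (Num.min e 1) => /=; first by rewrite lt_min e0 ltr01.
  move=> xy /= xye; apply: eE => /=.
  apply: (@le_ball _ _ _ (Num.min e 1)); first by rewrite ge_min lexx.
  by apply: ball_dist_ball => //; rewrite ge_min lexx orbT.
- have e20 : 0 < e / 2 by rewrite divr_gt0.
  exists (e / 2) => // xy /= xye; apply: eE => /=.
  apply/ball_dist_ltP; exists (e / 2); first by split => //; right.
  by rewrite ltr_pdivrMr// ltr_pMr// ltr1n.
Qed.

Lemma ball_dist_positivity x y : ball_dist x y = 0 -> x = y.
Proof.
move=> xy0; move: hT; rewrite ball_hausdorff => h.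
apply/eqP/negPn/negP => /h[[e1 e2]] /=.
set e := Num.min (Num.min e1%:num e2%:num) 1.
have e0 : 0 < e by rewrite !lt_min !gt0.
have xy : ball x e y by apply: ball_dist_ball; rewrite ?xy0// ge_min lexx orbT.
apply/negP/set0P; exists y; split; last exact: ballxx.
by apply: le_ball xy; rewrite !ge_min lexx.
Qed.

HB.instance Definition _ := Uniform.copy (metrized hT) T.

HB.instance Definition _ := @Uniform_isPseudoMetric.Build R (metrized hT)
  (fun x e => [set y : T | ball_dist x y < e])
  (fun x e (e0 : 0 < e) => eq_ind_r (fun d => d < e) e0 (ball_distxx x))
  (fun x y e (xy : ball_dist x y < e) =>
     eq_ind _ (fun d => d < e) xy _ (ball_dist_sym x y))
  (fun x y z e1 e2 (xy : ball_dist x y < e1) (yz : ball_dist y z < e2) =>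
     le_lt_trans (ball_dist_triangle y x z) (ltrD xy yz))
  ball_dist_entourageE.

HB.instance Definition _ := @PseudoMetric_isMetric.Build R (metrized hT)
  ball_dist ball_dist_ge0 ball_dist_positivity (fun _ _ => erefl).

End metrized.

Notation Z2 := (int * int)%type.

(* Each [tds_act v] is a homeomorphism, with inverse [tds_act (- v)]. *)
Record Z2tds (R : realType) := Z2TDS {
  tds_space :> metricType R ;
  tds_act : Z2 -> tds_space -> tds_space ;
  tds_compact : compact [set: tds_space] ;
  tds_act0 : forall x, tds_act 0 x = x ;
  tds_actD : forall u v x, tds_act (u + v) x = tds_act u (tds_act v x) ;
  tds_act_continuous : forall v, continuous (tds_act v)
}.

Section entropy.
Context {R : realType}.

Definition open_cover (T : topologicalType) (U : set (set T)) :=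
  U `<=` open /\ cover U id = setT.

(* A minimum when U has a finite subcover, which holds for every open cover of
   a compact space. *)
Definition subcover_card (T : Type) (U : set (set T)) : R :=
  inf [set (#|` V|%fset)%:R | V in [set V : {fset set T} |
         [set` V] `<=` U /\ cover [set` V] id = setT]].

(* The join of the family of covers (C i), i in D. *)
Definition cover_join (I T : Type) (D : set I) (C : I -> set (set T)) :
    set (set T) :=
  [set \bigcap_(i in D) B i | B in [set B : I -> set T |
     forall i, D i -> C i (B i)]].

(* {1, ..., n}^2 *)
Definition box (n : nat) : set Z2 :=
  [set v | (1 <= v.1 <= n%:Z) && (1 <= v.2 <= n%:Z)].

Definition act_cover (X : Z2tds R) (v : Z2) (U : set (set X)) : set (set X) :=
  [set tds_act v @` B | B in U].

(* The limit exists by subadditivity; the term n = 0 plays no role. *)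
Definition cover_entropy (X : Z2tds R) (U : set (set X)) : R :=
  limn (fun n : nat => (n%:R ^+ 2)^-1 *
    ln (subcover_card (cover_join (box n) (fun v => act_cover v U)))).

Definition entropy (X : Z2tds R) : \bar R :=
  ereal_sup [set (cover_entropy U)%:E | U in @open_cover X].

Definition factor_map (X Y : Z2tds R) (phi : X -> Y) :=
  continuous phi /\ forall v x, phi (tds_act v x) = tds_act v (phi x).

(* The library's [zero_dimensional] only asks that clopen sets separate
   points. *)
Definition clopen_basis (T : topologicalType) :=
  exists2 B : set (set T), B `<=` clopen & basis B.

Definition TCPE (X : Z2tds R) :=
  forall (Y : Z2tds R) (phi : X -> Y), factor_map phi -> range phi = setT ->
    (0 < entropy Y)%E \/ exists y : Y, [set: Y] = [set y].

Definition ZTCPE (X : Z2tds R) :=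
  forall (Y : Z2tds R) (phi : X -> Y), clopen_basis Y ->
    factor_map phi -> range phi = setT ->
    (0 < entropy Y)%E \/ exists y : Y, [set: Y] = [set y].

End entropy.

(* A^(Z^2), with the product of the discrete topologies. *)
Definition config (A : finType) := {ptws Z2 -> discrete_topology A}.

Definition shift (A : finType) (t : Z2) (x : config A) : config A :=
  fun s => x (s + t).

Record subshift (A : finType) := Subshift {
  subshift_set :> set (config A) ;
  subshift_nonempty : subshift_set !=set0 ;
  subshift_closed : closed subshift_set ;
  subshift_invariant : forall t x, subshift_set x -> subshift_set (shift t x)
}.

(* An element of A^S for some finite subset S of Z^2, namely S = domf p. *)
Definition pattern (A : finType) := {fmap Z2 -> A}.

Definition appears (A : finType) (p : pattern A) (x : config A) :=
  exists t : Z2, forall s : domf p, x (fsval s + t) = p s.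

Definition is_sft (A : finType) (X : subshift A) :=
  exists F : {fset pattern A},
    subshift_set X = [set x | forall p, p \in F -> ~ appears p x].

Section subshift_tds.
Context (R : realType) {A : finType} (X : subshift A).

Lemma config_compact : compact [set: config A].
Proof.
have := @tychonoff Z2 (fun=> discrete_topology A) (fun=> setT).
have -> : [set f : Z2 -> discrete_topology A | forall i, setT (f i)] = setT.
  by apply/seteqP; split.
by apply=> _; apply: finite_compact; exact: finite_finset.
Qed.

Lemma config_hausdorff : hausdorff_space (config A).
Proof.
apply: (@hausdorff_product Z2 (fun=> discrete_topology A)) => _.
exact: discrete_hausdorff.
Qed.

Lemma shift_continuous (t : Z2) : continuous (@shift A t).
Proof.
move=> x.
have FF : Filter (shift t @ nbhs x) by apply: fmap_filter.
have [_] := @cvg_sup (config A) Z2 (fun i => Topological.class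
  (initial_topology (fun f : config A => f i))) _ (shift t x) FF.
apply=> i B [_ [[C oC <-] Cx] /filterS]; apply.
apply: (@proj_continuous Z2 (fun=> discrete_topology A) (i + t) x C).
exact: open_nbhs_nbhs.
Qed.

Lemma subshift_hausdorff : hausdorff_space (set_type X).
Proof.
move=> x y xy; apply: val_inj; apply: config_hausdorff => U V Ux Vy.
have cv : continuous (set_val : X -> config A) by exact: initial_continuous.
by have [z [Uz Vz]] := xy _ _ (cv _ _ Ux) (cv _ _ Vy); exists (set_val z).
Qed.

Lemma subshift_compact : compact [set: set_type X].
Proof.
have cX : compact X.
  exact: subclosed_compact (@subshift_closed _ X) config_compact _.
move=> F PF _.
have [|p [Xp Fp]] := cX (set_val @ F) (fmap_proper_filter _ _).
  by apply: (@filterE _ F) => x; exact: (@set_valP _ X x).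
pose q : set_type X := SigSub (mem_set Xp).
exists q; split=> // B C FB [_ [[D oD <-] /= Dp DC]].
have [||y [[x Bx <-] Dx]] := Fp (set_val @` B) D.
- by apply: (@filterS _ F _ B) => // x Bx; exists x.
- exact: open_nbhs_nbhs.
- by exists x; split=> //; exact: DC.
Qed.

Definition subshift_act (t : Z2) (x : set_type X) : set_type X :=
  SigSub (mem_set (@subshift_invariant _ X t _ (set_valP x))).

Lemma subshift_act0 x : subshift_act 0 x = x.
Proof. by apply: val_inj; apply/funext => s /=; rewrite /shift addr0. Qed.

Lemma subshift_actD u v x :
  subshift_act (u + v) x = subshift_act u (subshift_act v x).
Proof. by apply: val_inj; apply/funext => s /=; rewrite /shift addrA. Qed.

Lemma subshift_act_continuous t : continuous (subshift_act t).
Proof.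
apply/continuousP => _ [D oD <-]; exists (@shift A t @^-1` D) => //.
by have /continuousP := @shift_continuous t; exact.
Qed.

(* The subspace topology of A^(Z^2) on X, with a metric inducing it. *)
Definition subshift_space : metricType R := metrized subshift_hausdorff.

Definition subshift_tds : Z2tds R := @Z2TDS R subshift_space subshift_act
  subshift_compact subshift_act0 subshift_actD subshift_act_continuous.

End subshift_tds.

(* Main.v *)
Require Import Defs.
From HB Require Import structures.
From mathcomp Require Import all_boot all_order all_algebra finmap zify ring lra.
From mathcomp Require Import all_classical all_reals all_analysis.

Set Implicit Arguments.
Unset Strict Implicit.
Unset Printing Implicit Defensive.

Import Order.TTheory GRing.Theory Num.Theory.
Import numFieldNormedType.Exports.
Local Open Scope classical_set_scope.
Local Open Scope ring_scope.

(** The subshift consists of arrays of digits 0, 1, 2, 3 in which all rows are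
    base 3 expansions of the same number modulo 1, at each column. This is a
    condition of finite type: two expansions agree modulo 1 exactly when they are
    related by bounded carries, and the symbols record the carries between
    consecutive rows. The digit 3 makes expansions redundant.

    Failure of TCPE. The expansion [t] to the right of a site depends
    continuously on the configuration, and [cos (2 pi t)] depends only on its
    column. Recording this function along orbits gives a nontrivial factor on
    which the vertical shift is trivial, and such a factor has zero entropy: the
    join of a cover over an n by n box involves n translates only
    ([entropy_vertical_trivial], [not_TCPE_vertical], [carry_sft_not_TCPE]). This
    factor is connected, which is why clopen sets do not see it.

    ZTCPE. Let [B] be a clopen subset of a factor of zero entropy. Whether a
    point lies over [B] is decided in a finite window ([clopen_local]). Fix a
    length [L] larger than the window and consider words of [L] digits with a
    given integer value [V]. Such words can be placed independently in all the
    horizontal segments of length [L] of the plane, since they all carry nothing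
    across their ends. If [B] distinguished two arrangements with the same value
    [V], these could be exchanged freely in disjoint squares and the factor would
    have positive entropy ([mosaic_entropy]). So the answer depends on [V] only.
    It does not depend on [V] either: a word of value [V + 1] may be chosen to
    differ from one of value [V] in the last digit alone, outside the window
    ([block_pred], [flexible_family_zero]). Finally each pattern of the subshift
    extends, by one digit on each side, to an arrangement of words of equal value
    ([row_blockP], [row_block_window]), so [B] is empty or full
    ([flexible_constant]).

    The number of values [V] is exponential in the size of the window: any two
    patterns are connected by exchanges, but the chains are of unbounded length,
    as a connected factor requires. *)

(** * Covers and their joins *)

Lemma cvg_ptws (I : Type) (T : topologicalType) (J : Type) (F : set_system J)
    (f : J -> {ptws I -> T}) (x : {ptws I -> T}) : Filter F ->
  (forall i, f j i @[j --> F] --> x i) -> f @ F --> x.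
Proof.
move=> FF fx; have fFF : Filter (f @ F) by exact: fmap_filter.
have [_] := @cvg_sup {ptws I -> T} I (fun i => Topological.class
  (initial_topology (fun y : {ptws I -> T} => y i))) _ x fFF.
apply=> i B [_ [[C oC <-] Cx] /filterS]; apply.
by apply: (fx i C); exact: open_nbhs_nbhs.
Qed.

(** Families indexed by ['I_K] may repeat members, which makes them easier to
    combine than finite sets of sets; the least such [K] is [subcover_card]. *)
Definition coverable (T : Type) (U : set (set T)) (K : nat) :=
  exists c : 'I_K -> set T, (forall i, U (c i)) /\ forall x, exists i, c i x.

Lemma coverable_fset (T : Type) (U : set (set T)) (V : {fset set T}) :
  [set` V] `<=` U -> cover [set` V] id = setT -> coverable U #|` V|%fset.
Proof.
move=> VU Vc; exists (fun i => tnth (in_tuple (enum_fset V)) i); split.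
  by move=> i; apply: VU => /=; exact: mem_tnth.
move=> x; have : cover [set` V] id x by rewrite Vc.
by move=> [B /= BV Bx]; have /tnthP[i Bi] : B \in in_tuple (enum_fset V) by [];
  exists i; rewrite -Bi.
Qed.

Lemma fset_coverable (T : Type) (U : set (set T)) (K : nat) :
  coverable U K -> exists V : {fset set T},
    [/\ [set` V] `<=` U, cover [set` V] id = setT & (#|` V|%fset <= K)%N].
Proof.
move=> [c [cU cT]]; exists [fset c i | i in 'I_K]%fset; split.
- by move=> B /= /imfsetP[i _ ->].
- rewrite -subTset => x _; have [i ci] := cT x.
  by exists (c i) => //=; apply/imfsetP; exists i.
- by rewrite (leq_trans (leq_imfset_card _ _ _))// -[leqRHS]card_ord cardE.
Qed.

Section subcover_card.
Context {R : realType} {T : Type}.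
Implicit Type U : set (set T).

Lemma subcover_card_attained U K0 : coverable U K0 ->
  exists2 K, coverable U K &
    subcover_card U = K%:R :> R /\ forall K', coverable U K' -> (K <= K')%N.
Proof.
move=> cov0.
have [|K /asboolP covK minK] := @ex_minnP (fun K => `[< coverable U K >]).
  by exists K0; exact/asboolP.
have {}minK K' : coverable U K' -> (K <= K')%N by move=> ?; exact/minK/asboolP.
exists K => //; split=> //; apply/eqP; rewrite eq_le; apply/andP; split.
  have [V [VU VT VK]] := fset_coverable covK.
  apply: le_trans (_ : (#|` V|%fset)%:R <= _); last by rewrite ler_nat.
  apply: ge_inf; last by exists V.
  by exists 0 => _ [? _ <-].
have [V [VU VT VK]] := fset_coverable covK.
apply: lb_le_inf; first by exists (#|` V|%fset)%:R, V.
move=> _ [W [/= WU WT] <-].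
by rewrite ler_nat; apply: minK; exact: coverable_fset.
Qed.

Lemma subcover_card_le U K : coverable U K -> subcover_card U <= K%:R :> R.
Proof.
move=> covK; have [K' _ [-> minK]] := subcover_card_attained covK.
by rewrite ler_nat minK.
Qed.

Lemma subcover_card_ge1 U K : inhabited T ->
  coverable U K -> 1 <= subcover_card U :> R.
Proof.
move=> [t] covK; have [K' [c [_ /(_ t)[i _]]] [-> _]] := subcover_card_attained covK.
by rewrite ler1n (leq_ltn_trans _ (ltn_ord i)).
Qed.

(** No member of the cover can serve two of the points [y s], so the points
    inject into any subcover. *)
Lemma subcover_card_ge (S : finType) (y : S -> T) U K : coverable U K ->
  (forall B s s', U B -> B (y s) -> B (y s') -> s = s') ->
  #|S|%:R <= subcover_card U :> R.
Proof.
move=> covK sep; have [K' [c [cU cT]] [-> _]] := subcover_card_attained covK.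
rewrite ler_nat; have [h hP] := choice (fun s => cT (y s)).
rewrite -[leqRHS]card_ord; apply: (@leq_card _ _ h) => s s' hs.
by apply: (sep (c (h s))) => //; rewrite hs.
Qed.

End subcover_card.

(** Choose one member of the [i]-th family for each [i]: the intersection of the
    choices lies inside a member of the join as soon as each factor of the join
    is refined by one of the families. *)
Lemma coverable_join (T J : Type) (I : finType) (K : nat) (D : set J)
    (C : J -> set (set T)) (h : J -> I) (c : I -> 'I_K -> set T) :
  (forall i x, exists a, c i a x) ->
  (forall v, D v -> forall a, exists2 B, C v B & c (h v) a `<=` B) ->
  coverable (cover_join D C) (K ^ #|I|).
Proof.
move=> cT cC.
have /choice[B BP] : forall va : J * 'I_K, exists B, D va.1 -> C va.1 B /\
    c (h va.1) va.2 `<=` B.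
  move=> [v a] /=; have [Dv|nDv] := pselect (D v); last by exists set0.
  by have [B] := cC v Dv a; exists B.
rewrite -[K in (K ^ _)%N]card_ord -card_ffun.
exists (fun i => \bigcap_(v in D) B (v, (enum_val i : {ffun I -> 'I_K}) (h v))).
split=> [i|x].
  exists (fun v => B (v, (enum_val i : {ffun I -> 'I_K}) (h v))) => // v Dv.
  by have [] := BP (v, (enum_val i : {ffun I -> 'I_K}) (h v)) Dv.
have /choice[a aP] := fun i => cT i x.
exists (enum_rank [ffun i => a i]) => v Dv; rewrite enum_rankK ffunE.
by have [_] := BP (v, a (h v)) Dv; apply; exact: aP.
Qed.

Lemma compact_coverable (T : topologicalType) (U : set (set T)) :
  compact [set: T] -> open_cover U -> exists K, coverable U K.
Proof.
move=> cT [Uo UT].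
have [[t _]|nT] := pselect ([set: T] !=set0); last first.
  by exists 0%N, (fun=> set0); split=> [[]//|x]; case: nT; exists x.
(* [compact_cover] asks for a pointed space: [t] is the base point. *)
pose pT : ptopologicalType := HB.pack (T : Type) T (isPointed.Build T t).
have : @compact pT setT by exact: cT.
rewrite compact_cover => /(_ _ U id)[||D DU DT]; first exact: Uo.
  by move=> x _; have : cover U id x by rewrite UT.
exists #|` D|%fset; apply: coverable_fset; first by move=> B /DU; rewrite inE.
by rewrite -subTset.
Qed.

Lemma cvg_natV (R : realType) : (fun n : nat => n%:R^-1 : R) @ \oo --> (0 : R).
Proof.
have pos : \forall k \near \oo, (0 : R) < k%:R.
  by near=> k; rewrite ltr0n; near: k; exact: nbhs_infty_gt.
exact: (gtr0_cvgV0 pos).2 cvgr_idn.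
Unshelve. all: by end_near. Qed.

(** Fekete's lemma on squares. The hypothesis bounds the normalized sequence at
    [n] by its value at [m] times [(1 + m / n)^2], so it tends to its infimum. *)
Lemma cvg_square_subadditive (R : realType) (b : nat -> R) :
  (forall n, 0 <= b n) ->
  (forall m n, (0 < m)%N -> b n <= ((n %/ m).+1 ^ 2)%:R * b m) ->
  cvgn (fun n => (n%:R ^+ 2)^-1 * b n).
Proof.
move=> b0 bs; set a := fun n => _.
have a0 n : 0 <= a n by rewrite mulr_ge0// invr_ge0 sqr_ge0.
pose S := [set a m | m in [set m | (0 < m)%N]].
have S0 : has_inf S by split; [exists (a 1%N), 1%N|exists 0 => _ [m _ <-]].
apply/cvg_ex; exists (inf S); apply/cvgrPdist_lt => e e0.
have [_ [m m0 <-] me] : exists2 x, S x & x < inf S + e.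
  by apply: inf_lt; [exact: S0.1|rewrite ltrDl].
have mR0 : (0 : R) < m%:R by rewrite ltr0n.
have lim_a : (fun n => (1 + m%:R * (n%:R)^-1) ^+ 2 * a m) @ \oo --> a m.
  have h : (fun n : nat => 1 + m%:R * (n%:R)^-1 : R) @ \oo --> (1 + m%:R * 0 : R).
    apply: cvgD; first exact: cvg_cst.
    apply: (@cvgMl_tmp _ _ _ _ (fun n : nat => (n%:R)^-1) m%:R 0).
    exact: cvg_natV.
  have := cvgM (cvgM h h) (cvg_cst (a m)).
  rewrite mulr0 addr0 !mul1r => lim.
  by under eq_fun do rewrite expr2; exact: lim.
have /cvgrPdist_lt/(_ (inf S + e - a m)) := lim_a.
rewrite subr_gt0 => /(_ me) a_near.
near=> n.
have n0 : (0 < n)%N by near: n; exact: nbhs_infty_gt.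
have nR0 : (0 : R) < n%:R by rewrite ltr0n.
rewrite distrC ger0_norm; last first.
  by rewrite subr_ge0; apply: ge_inf; [case: S0|exists n].
rewrite ltrBlDl.
apply: le_lt_trans (_ : _ <= (1 + m%:R * (n%:R)^-1) ^+ 2 * a m) _; last first.
  have : `|a m - (1 + m%:R / n%:R) ^+ 2 * a m| < inf S + e - a m by near: n.
  by rewrite distrC => /ltr_normlP[_]; lra.
apply: le_trans (_ : _ <= (n%:R ^+ 2)^-1 * (((n %/ m).+1 ^ 2)%:R * b m)) _.
  by rewrite ler_wpM2l ?invr_ge0 ?sqr_ge0// bs.
rewrite /a !mulrA ler_wpM2r// natrX -!exprVn -!exprMn lerXn2r ?nnegrE//.
have -> : (1 + m%:R / n%:R) / m%:R = n%:R^-1 * ((n%:R + m%:R) / m%:R) :> R.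
  by field; rewrite !gt_eqF.
rewrite ler_wpM2l ?invr_ge0 ?ler0n// ler_pdivlMr// -natrM -natrD ler_nat.
by rewrite mulSn addnC leq_add2r leq_divM.
Unshelve. all: by end_near. Qed.

(** * Entropy of a single cover *)

Section tds.
Context {R : realType}.
Implicit Type X : Z2tds R.

(** [cover_entropy U] is the limit of the logarithms of these numbers divided by
    [n ^ 2]. *)
Definition join_card X (U : set (set X)) (n : nat) : R :=
  subcover_card (cover_join (box n) (fun v => act_cover v U)).

Lemma tds_actNK X v : cancel (@tds_act R X v) (tds_act (- v)).
Proof. by move=> x; rewrite -tds_actD addNr tds_act0. Qed.

Lemma tds_actKN X v : cancel (@tds_act R X (- v)) (tds_act v).
Proof. by move=> x; rewrite -tds_actD subrr tds_act0. Qed.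

Lemma coverable_box X (U : set (set X)) n : open_cover U ->
  exists K, coverable (cover_join (box n) (fun v => act_cover v U)) K.
Proof.
move=> oU; have [K [c [cU cT]]] := compact_coverable (@tds_compact R X) oU.
exists (K ^ #|{: 'I_n.+1 * 'I_n.+1}|)%N.
apply: (@coverable_join _ _ _ _ _ _
  (fun v : Z2 => (inord `|v.1|%N : 'I_n.+1, inord `|v.2|%N : 'I_n.+1))
  (fun i a => tds_act (i.1 : int, i.2 : int) @` c a)).
  move=> i x; have [a ca] := cT (tds_act (- (i.1 : int, i.2 : int)) x).
  by exists a; exists (tds_act (- (i.1 : int, i.2 : int)) x) => //; rewrite tds_actKN.
move=> [v1 v2] /andP[/= v1n v2n] a.
exists (tds_act (v1, v2) @` c a); first by exists (c a).
rewrite !inordK; [|lia..].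
by rewrite !gez0_abs; [|lia..].
Qed.

(** The box of side [n] is covered by [(n / m + 1)^2] translates of the box of
    side [m], and a translate of the join is the join over the translate. *)
Lemma coverable_box_div X (U : set (set X)) m n K : (0 < m)%N ->
  coverable (cover_join (box m) (fun v => act_cover v U)) K ->
  coverable (cover_join (box n) (fun v => act_cover v U)) (K ^ (n %/ m).+1 ^ 2).
Proof.
move=> m0 [c [cU cT]].
set q := (n %/ m).+1.
have -> : (q ^ 2)%N = #|{: 'I_q * 'I_q}| by rewrite card_prod card_ord mulnn.
pose tr (i : 'I_q * 'I_q) : Z2 := ((m * i.1)%N%:Z, (m * i.2)%N%:Z).
apply: (@coverable_join _ _ _ _ _ _
  (fun v : Z2 => (inord ((`|v.1|%N).-1 %/ m) : 'I_q, inord ((`|v.2|%N).-1 %/ m)))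
  (fun i a => tds_act (tr i) @` c a)).
  move=> i x; have [a ca] := cT (tds_act (- tr i) x).
  by exists a; exists (tds_act (- tr i) x) => //; rewrite tds_actKN.
move=> [v1 v2] /andP[/= v1n v2n] a.
have [B BU cB] := cU a.
set i1 := ((`|v1|%N).-1 %/ m)%N; set i2 := ((`|v2|%N).-1 %/ m)%N.
have lt_q (v : int) : 1 <= v <= n%:Z -> ((`|v|%N).-1 %/ m < q)%N.
  by move=> vn; rewrite ltnS leq_div2r//; lia.
have tr_box : box m (v1 - (m * i1)%N%:Z, v2 - (m * i2)%N%:Z).
  have h1 := divn_eq (`|v1|%N).-1 m; have h2 := divn_eq (`|v2|%N).-1 m.
  have l1 := ltn_pmod (`|v1|%N).-1 m0; have l2 := ltn_pmod (`|v2|%N).-1 m0.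
  by rewrite /box /=; apply/andP; split; lia.
have [B0 B0U B0B] := BU _ tr_box.
exists (tds_act (v1, v2) @` B0); first by exists B0.
move=> _ [y cy <-]; have : B (v1 - (m * i1)%N%:Z, v2 - (m * i2)%N%:Z) y.
  by move: cy; rewrite -cB; apply.
rewrite -B0B => -[z B0z <-]; exists z => //.
rewrite -tds_actD /tr /= !inordK; [|exact: lt_q..].
by congr tds_act; apply: injective_projections; rewrite /= addrC subrK.
Qed.

(** Convergence is what allows a bound on [join_card], valid for all large boxes,
    to pass to [cover_entropy]. *)
Lemma cvg_cover_entropy X (U : set (set X)) : [set: X] !=set0 -> open_cover U ->
  cvgn (fun n : nat => (n%:R ^+ 2)^-1 * ln (join_card U n)).
Proof.
move=> [x _] oU.
have card_ge1 n : 1 <= join_card U n.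
  have [K covK] := coverable_box n oU.
  by apply: subcover_card_ge1 covK; constructor.
apply: cvg_square_subadditive => [n|m n m0]; first exact: ln_ge0.
have [K0 /(@subcover_card_attained R)[K covK [mK _]]] := coverable_box m oU.
rewrite mulr_natl -lnXn ?(lt_le_trans _ (card_ge1 m))// ler_ln ?posrE; last 2 first.
- by rewrite (lt_le_trans _ (card_ge1 n)).
- by rewrite exprn_gt0// (lt_le_trans _ (card_ge1 m)).
rewrite /join_card mK -natrX.
by apply: subcover_card_le; exact: coverable_box_div.
Qed.

End tds.

Section entropy_bounds.
Context {R : realType}.
Implicit Type X : Z2tds R.

(** The hypothesis says that each square of side [M] carries at least one free
    binary choice, independent of the other squares. *)
Lemma entropy_gt0 X (U : set (set X)) (M : nat) : [set: X] !=set0 ->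
  open_cover U -> (0 < M)%N ->
  (forall n, (2 ^ (n %/ M) ^ 2)%:R <= join_card U n) -> (0 < entropy X)%E.
Proof.
move=> X0 oU M0 joinU; have M0' : (0 : R) < M%:R by rewrite ltr0n.
have ln2 : (0 : R) < ln 2 by rewrite ln_gt0 ?ltr1n.
have c0 : (0 : R) < ln 2 / (2 * M%:R) ^+ 2.
  by rewrite divr_gt0// exprn_gt0// mulr_gt0.
apply: (@lt_le_trans _ _ (cover_entropy U)%:E); last first.
  by apply: ereal_sup_ubound; exists U.
rewrite lte_fin; apply: lt_le_trans c0 _.
apply: limr_ge; first exact: cvg_cover_entropy.
exists M => // n /= Mn; have n0 : (0 < n)%N by rewrite (leq_trans M0).
have n0' : (0 : R) < n%:R by rewrite ltr0n.
have le_ln : ln 2 *+ (n %/ M) ^ 2 <= ln (join_card U n).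
  rewrite -lnXn ?ltr0n// ler_ln ?posrE -?natrX ?joinU// ?ltr0n ?expn_gt0//.
  by apply: lt_le_trans (joinU n); rewrite ltr0n expn_gt0.
rewrite ler_pdivlMl ?exprn_gt0//; apply: le_trans le_ln.
rewrite mulrCA -(mulr_natr (ln 2)) ler_pM2l//.
rewrite ler_pdivrMr ?exprn_gt0 ?mulr_gt0// -natrX -natrM -natrX -natrM ler_nat.
rewrite -expnMn leq_sqr.
have := divn_eq n M; have := ltn_pmod n M0; have : (0 < n %/ M)%N by rewrite divn_gt0.
nia.
Qed.

(** The translates of a cover by [(i, j)] and by [(i, 0)] coincide, so the join
    over a box of side [n] is a join of [n] covers: its logarithm is linear in
    [n], to be compared with [n ^ 2]. *)
Lemma entropy_vertical_trivial X : [set: X] !=set0 ->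
  (forall i j x, @tds_act R X (i, j) x = tds_act (i, 0) x) -> entropy X = 0%E.
Proof.
move=> X0 vert; have [x _] := X0.
have entropyU (U : set (set X)) : open_cover U -> cover_entropy U = 0.
  move=> oU; have [K covK] := compact_coverable (@tds_compact R X) oU.
  have covn n : coverable (cover_join (box n) (fun v => act_cover v U)) (K ^ n).
    have [c [cU cT]] := covK; rewrite -[n in (K ^ n)%N]card_ord.
    have cov0 : box 0 = set0.
      by apply/seteqP; split=> // -[v1 v2] /andP[/= h _]; lia.
    case: n => [|n].
      exists (fun=> setT); split=> [i|]; last first.
        by rewrite card_ord expn0; exists ord0.
      exists (fun=> setT); first by rewrite cov0.
      by rewrite cov0 bigcap_set0.
    apply: (@coverable_join _ _ _ _ _ _ (fun v : Z2 => inord (`|v.1|%N).-1 : 'I_n.+1)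
      (fun i a => tds_act (i.+1%:Z, 0) @` c a)).
      move=> i y; have [a ca] := cT (tds_act (- (i.+1%:Z, 0)) y).
      by exists a; exists (tds_act (- (i.+1%:Z, 0)) y) => //; rewrite tds_actKN.
    move=> [v1 v2] /andP[/= v1n v2n] a; exists (tds_act (v1, v2) @` c a).
      by exists (c a).
    rewrite inordK; last lia.
    move=> _ [y cy <-]; exists y => //; rewrite vert; congr (tds_act (_, _)); lia.
  apply/cvg_lim => //.
  have K_ge1 : (1 : R) <= K%:R.
    apply: le_trans (subcover_card_le covK).
    by apply: subcover_card_ge1 covK; constructor.
  apply: (@squeeze_cvgr _ _ _ _ (fun=> 0) (fun n : nat => ln K%:R * n%:R^-1)).
  - near=> n; have n0 : (0 : R) < n%:R.
      by rewrite ltr0n; near: n; exact: nbhs_infty_gt.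
    have joinge1 : 1 <= join_card U n.
      by apply: subcover_card_ge1 (covn n); constructor.
    apply/andP; split; first by rewrite mulr_ge0 ?invr_ge0 ?sqr_ge0// ln_ge0.
    rewrite ler_pdivrMl ?exprn_gt0// [leRHS](_ : _ = ln K%:R * n%:R); last first.
      by field; rewrite gt_eqF.
    rewrite mulr_natr -lnXn ?(lt_le_trans _ K_ge1)//.
    rewrite ler_ln ?posrE ?exprn_gt0 ?(lt_le_trans _ K_ge1)//.
      by rewrite -natrX; exact: subcover_card_le.
    exact: lt_le_trans joinge1.
  - exact: cvg_cst.
  - by rewrite -(mulr0 (ln K%:R)); apply: cvgMl_tmp; exact: cvg_natV.
apply/eqP; rewrite eq_le; apply/andP; split.
  by apply: ge_ereal_sup => _ [U oU <-]; rewrite entropyU.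
apply: ereal_sup_ubound; exists [set setT].
  split; first by move=> _ ->; exact: openT.
  by rewrite -subTset => y _; exists setT.
rewrite entropyU//; split; first by move=> _ ->; exact: openT.
by rewrite -subTset => y _; exists setT.
Unshelve. all: by end_near. Qed.

End entropy_bounds.

(** * Factors that record a function along orbits *)

Section orbit_coding.
Context {R : realType} (X : Z2tds R) (g : X -> R).
Hypothesis g_cont : continuous g.

(** Recording [g] along the whole orbit turns any continuous function into an
    equivariant map, hence into a factor. *)
Definition orbit_code (x : X) : {ptws Z2 -> R} := fun v => g (tds_act v x).

Let Y := range orbit_code.

Lemma orbit_code_continuous : continuous orbit_code.
Proof.
move=> x; apply: cvg_ptws => v.
apply: (@continuous_comp _ _ _ (tds_act v) g); last exact: g_cont.
exact: tds_act_continuous.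
Qed.

Lemma code_hausdorff : hausdorff_space (set_type Y).
Proof.
have Rh : hausdorff_space {ptws Z2 -> R}.
  by apply: (@hausdorff_product Z2 (fun=> R)) => _; exact: Rhausdorff.
move=> x y xy; apply: val_inj; apply: Rh => U V Ux Vy.
have cv : continuous (set_val : Y -> {ptws Z2 -> R}) by exact: initial_continuous.
by have [z [Uz Vz]] := xy _ _ (cv _ _ Ux) (cv _ _ Vy); exists (set_val z).
Qed.

Definition code_space : metricType R := metrized code_hausdorff.

Definition code_map (x : X) : code_space :=
  SigSub (mem_set (ex_intro2 _ _ x I erefl) : orbit_code x \in Y).

Lemma code_map_surj : range code_map = setT.
Proof.
rewrite -subTset => -[y yY] _; have [x _ xy] := set_mem yY.
by exists x => //; apply: val_inj.
Qed.

Lemma code_map_continuous : continuous code_map.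
Proof.
apply/continuousP => _ [D oD <-].
by have /continuousP := orbit_code_continuous; exact.
Qed.

Lemma code_compact : compact [set: code_space].
Proof.
rewrite -code_map_surj; apply: continuous_compact; last exact: tds_compact.
exact/continuous_subspaceT/code_map_continuous.
Qed.

Definition real_shift (t : Z2) (y : {ptws Z2 -> R}) : {ptws Z2 -> R} :=
  fun s => y (s + t).

Lemma code_invariant (t : Z2) (y : {ptws Z2 -> R}) : Y y -> Y (real_shift t y).
Proof.
move=> [x _ <-]; exists (tds_act t x) => //.
by apply/funext => s; rewrite /real_shift /orbit_code tds_actD.
Qed.

Definition code_act (t : Z2) (y : code_space) : code_space :=
  SigSub (mem_set (code_invariant t (set_valP y))).

Lemma code_act0 y : code_act 0 y = y.
Proof. by apply: val_inj; apply/funext => s /=; rewrite /real_shift addr0. Qed.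

Lemma code_actD u v y : code_act (u + v) y = code_act u (code_act v y).
Proof. by apply: val_inj; apply/funext => s /=; rewrite /real_shift addrA. Qed.

Lemma real_shift_continuous (t : Z2) : continuous (real_shift t).
Proof.
move=> y.
apply: (@cvg_ptws Z2 R _ (nbhs y) (real_shift t) (real_shift t y)) => v.
exact: (@proj_continuous Z2 (fun=> R) (v + t) y).
Qed.

Lemma code_act_continuous t : continuous (code_act t).
Proof.
apply/continuousP => _ [D oD <-].
exists (real_shift t @^-1` D) => //.
by have /continuousP := @real_shift_continuous t; exact.
Qed.

Definition code_tds : Z2tds R := @Z2TDS R code_space code_act
  code_compact code_act0 code_actD code_act_continuous.

Lemma code_factor : factor_map (code_map : X -> code_tds).
Proof.
split; first exact: code_map_continuous.
move=> v x; apply: val_inj; apply/funext => s /=.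
by rewrite /real_shift /orbit_code tds_actD.
Qed.

End orbit_coding.

(** A continuous function that is constant along vertical orbits codes a factor
    on which the vertical shift acts trivially, hence of zero entropy. *)
Lemma not_TCPE_vertical {R : realType} (X : Z2tds R) (g : X -> R) :
  continuous g -> (forall i j x, g (tds_act (i, j) x) = g (tds_act (i, 0) x)) ->
  (exists x y, g x <> g y) -> ~ TCPE X.
Proof.
move=> cg vert [x [y gxy]] /(_ _ _ (code_factor cg) (code_map_surj g)).
case=> [|[z zT]].
  rewrite entropy_vertical_trivial ?ltxx//; first by exists (code_map g x).
  move=> i j [w wY]; apply: val_inj; apply/funext => -[a b] /=.
  have [u _ <-] := set_mem wY; rewrite /orbit_code.
  by rewrite [LHS]vert [RHS]vert.
apply: gxy; have : code_map g x = code_map g y.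
  have : [set: code_tds cg] (code_map g x) by [].
  have : [set: code_tds cg] (code_map g y) by [].
  by rewrite zT => -> ->.
move=> /(congr1 (fun u : code_space g => (set_val u : {ptws Z2 -> R}))) xy.
have : orbit_code g x 0 = orbit_code g y 0 by exact: (congr1 (fun f => f 0) xy).
by rewrite /orbit_code !tds_act0.
Qed.

(** * Cylinders and clopen sets of a subshift *)

Section cylinders.
Context {A : finType}.

Definition agree (n : nat) (x y : config A) :=
  forall v : Z2, (`|v.1| <= n)%N -> (`|v.2| <= n)%N -> x v = y v.

Lemma nbhs_site (x : config A) v : nbhs x [set y : config A | y v = x v].
Proof.
have := @proj_continuous Z2 (fun=> discrete_topology A) v x [set x v].
by apply; exact: discrete_set1.
Qed.

Lemma agree_nbhs n (x : config A) : nbhs x (agree n x).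
Proof.
pose v (i : 'I_n.+1 * 'I_n.+1 * bool * bool) : Z2 :=
  ((-1) ^+ i.1.2 * (i.1.1.1 : nat)%:Z, (-1) ^+ i.2 * (i.1.1.2 : nat)%:Z).
have near_v : \forall y \near x, forall i, y (v i) = x (v i).
  apply: (@filter_forall _ _ (fun i => [set y : config A | y (v i) = x (v i)])
    _ (nbhs_filter x)).
  by move=> i; exact: nbhs_site.
apply: (@filterS _ _ (nbhs_filter x) _ _ _ near_v).
move=> y yx w w1 w2.
have := yx (inord `|w.1|%N, inord `|w.2|%N, w.1 < 0, w.2 < 0).
rewrite /v /= !inordK ?ltnS// -!intEsign.
by case: w {w1 w2}.
Qed.

(** The filter generated by the cylinders around [x] converges coordinatewise,
    hence it converges to [x]. *)
Lemma nbhs_agree (x : config A) (U : set (config A)) :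
  nbhs x U -> exists n, forall y, agree n x y -> U y.
Proof.
pose F : set_system (config A) := filter_from setT (fun n => [set y | agree n x y]).
have FF : Filter F.
  apply: filter_from_filter; first by exists 0%N.
  move=> m n _ _; exists (maxn m n) => // y xy.
  by split=> v v1 v2; apply: xy; rewrite leq_max ?v1 ?v2 ?orbT.
have Fx : id @ F --> x.
  apply: cvg_ptws => v B /nbhs_singleton Bxv.
  exists (maxn `|v.1| `|v.2|) => // y xy; rewrite /= -(xy v)//.
    by rewrite leq_max leqnn.
  by rewrite leq_max leqnn orbT.
by move=> /Fx[n _ nU]; exists n.
Qed.

Lemma val_continuous (R : realType) (X : subshift A) :
  continuous (fun x : subshift_tds R X => set_val x : config A).
Proof. by apply/continuousP => D oD; exists D. Qed.

(** Each point has a cylinder on which membership in [B] is constant; compactness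
    bounds the sizes of these cylinders. *)
Lemma clopen_local (R : realType) (X : subshift A) (B : set (subshift_tds R X)) :
  clopen B -> exists n, forall x y : subshift_tds R X,
    agree n (set_val x) (set_val y) -> B x -> B y.
Proof.
move=> [oB cB].
have loc (C : set (subshift_tds R X)) x : open C -> C x -> exists n, forall y : subshift_tds R X,
    agree n (set_val x) (set_val y) -> C y.
  move=> [D oD <-] Dx; have [|n nD] := @nbhs_agree (set_val x) D.
    exact: open_nbhs_nbhs.
  by exists n => y /nD.
have oBC : open (~` B) by rewrite openC.
have cover_near := (compact_near_coveringP setT).1 (@tds_compact R (subshift_tds R X)).
have [|N _ /(_ N (leqnn N))] := cover_near nat \oo (fun n x =>
  forall y : subshift_tds R X, agree n (set_val x) (set_val y) -> B x -> B y).
- move=> x _; have [n nP] : exists n, forall y : subshift_tds R X,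
      agree n (set_val x) (set_val y) -> (B x <-> B y).
    have [Bx|nBx] := pselect (B x).
      by have [n nB] := loc B x oB Bx; exists n => y /nB.
    by have [n nB] := loc (~` B) x oBC nBx; exists n => y /nB nBy; split.
  have cyl : nbhs x [set y : subshift_tds R X | agree n (set_val x) (set_val y)].
    exact: (@val_continuous R X x _ (agree_nbhs n (set_val x))).
  exists ([set y : subshift_tds R X | agree n (set_val x) (set_val y)], [set m | (n <= m)%N]).
    by split => //; exists n.
  move=> [y m] /= [xy nm] z yz.
  have xz : agree n (set_val x) (set_val z).
    move=> v v1 v2; rewrite (xy v)// yz//; exact: leq_trans nm.
  by move=> /(nP _ xy).2 /(nP _ xz).1.
- by move=> H; exists N => x y; exact: H.
Qed.

End cylinders.

(** * The shift of finite type of redundant expansions *)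

(** A symbol is a digit [d] in {0, 1, 2, 3} and a carry [c] in {-1, 0, 1}, the
    carry being stored as [c + 1]. *)
Definition sym : finType := ('I_4 * 'I_3)%type.

(** With signed carries the rule at [v] reads
    [d v + c v = d (v + up) + 3 * c (v + left)]. If the row through [v] has the
    expansion [t] in base 3 to the right of [v], and the row above it has the
    expansion [t'], the rule for all sites of the row says that [t - t'] is the
    carry at [v]. Storing [c + 1] instead of [c]
    leaves the constant [3 - 1 = 2]. *)
Definition carry_rule (a b c : sym) : bool := (a.1 + a.2 + 2 == b.1 + 3 * c.2)%N.

Definition up : Z2 := (0, 1).
Definition left : Z2 := (-1, 0).

Definition carry_set : set (config sym) :=
  [set x | forall v, carry_rule (x v) (x (v + up)) (x (v + left))].

Definition zero_config : config sym := fun=> (ord0, inord 1).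

Lemma carry_set_zero : carry_set zero_config.
Proof. by move=> v; rewrite /carry_rule /= inordK. Qed.

Lemma carry_set_closed : closed carry_set.
Proof.
rewrite -openC openE => x /existsNP[v nxv].
have xF := nbhs_filter x.
have near_v := @filterI _ _ xF _ _ (nbhs_site x v)
  (@filterI _ _ xF _ _ (nbhs_site x (v + up)) (nbhs_site x (v + left))).
apply: (@filterS _ _ xF _ _ _ near_v).
by move=> y [/= y0 [y1 y2]] /(_ v); rewrite y0 y1 y2.
Qed.

Lemma carry_set_invariant (t : Z2) (x : config sym) : carry_set x -> carry_set (Defs.shift t x).
Proof.
move=> xX v; rewrite /Defs.shift [v + up + t]addrAC [v + left + t]addrAC.
exact: xX.
Qed.

Definition carry_sft : subshift sym := @Subshift sym carry_set
  (ex_intro _ _ carry_set_zero) carry_set_closed carry_set_invariant.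

Definition corner_pattern (abc : sym * sym * sym) : pattern sym :=
  [fmap].[0 <- abc.1.1].[up <- abc.1.2].[left <- abc.2]%fmap.

Lemma appears_corner_pattern a b c (x : config sym) :
  appears (corner_pattern (a, b, c)) x <->
  exists t, [/\ x t = a, x (t + up) = b & x (t + left) = c].
Proof.
have h0 : 0 \in domf (corner_pattern (a, b, c)) by rewrite !inE.
have h1 : up \in domf (corner_pattern (a, b, c)) by rewrite !inE.
have h2 : left \in domf (corner_pattern (a, b, c)) by rewrite !inE.
have pattern_val s (hs : s \in domf (corner_pattern (a, b, c))) :
    corner_pattern (a, b, c) [` hs]%fset = if s == left then c else if s == up then b else a.
  apply: Some_inj; rewrite -in_fnd !fnd_set.
  move: hs; rewrite !inE; case: (s == left) => //=; case: (s == up) => //=.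
  by case: (s == 0).
split=> [[t xt]|[t [xa xb xc]]]; exists t.
  by have := xt [` h0]%fset; have := xt [` h1]%fset; have := xt [` h2]%fset;
     rewrite !pattern_val /= add0r ![_ + t]addrC.
move=> [s hs]; rewrite pattern_val /= addrC.
case: eqP => [->//|/eqP n1]; case: eqP => [->//|/eqP n2].
move: hs; rewrite !inE (negbTE n1) (negbTE n2) !orbF => /eqP ->.
by rewrite addr0.
Qed.

Lemma carry_sft_is_sft : is_sft carry_sft.
Proof.
pose broken := [pred abc : sym * sym * sym | ~~ carry_rule abc.1.1 abc.1.2 abc.2].
exists [fset corner_pattern abc | abc in broken]%fset.
apply/seteqP; split=> [x xX _ /imfsetP[[[a b] c] /= + ->]|x xP v].
  move=> /negP nabc /appears_corner_pattern[t [xa xb xc]]; apply: nabc.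
  by rewrite /= -xa -xb -xc; exact: xX.
apply/negPn/negP => nxv; apply: (xP (corner_pattern (x v, x (v + up), x (v + left)))).
  by apply/imfsetP; exists (x v, x (v + up), x (v + left)); rewrite ?inE.
by apply/appears_corner_pattern; exists v.
Qed.

Definition dig (x : config sym) (i j : int) : nat := (x (i, j)).1.
Definition car (x : config sym) (i j : int) : nat := (x (i, j)).2.

Lemma addup (i j : int) : (i, j) + up = (i, j + 1).
Proof. by apply: injective_projections; rewrite /= ?addr0. Qed.

Lemma addleft (i j : int) : (i, j) + left = (i - 1, j).
Proof. by apply: injective_projections; rewrite /= ?addr0. Qed.

Lemma carry_setP (x : config sym) : carry_set x <-> forall i j,
  (dig x (i + 1) j + car x (i + 1) j + 2 = dig x (i + 1) (j + 1) + 3 * car x i j)%N.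
Proof.
split=> [xX i j|xX [i j]].
  by have /eqP := xX (i + 1, j); rewrite addup addleft addrK.
by apply/eqP; have := xX (i - 1) j; rewrite subrK addup addleft.
Qed.

(** * Expansions modulo 1: a factor of zero entropy *)

Section tail.
Context {R : realType}.
Implicit Types x : config sym.

(** The digits to the right of [(i, j)] read in base 3; since 3 is a
    digit, tails range over [[0, 3/2]], an interval longer than 1. *)
Definition tail_sum x i j n : R :=
  \sum_(k < n) (dig x (i + k.+1%:Z) j)%:R * 3^-1 ^+ k.+1.

Definition tail x i j : R := sup (range (tail_sum x i j)).

Lemma tail_sum0 x i j : tail_sum x i j 0 = 0.
Proof. by rewrite /tail_sum big_ord0. Qed.

Lemma tail_sumS x i j n : tail_sum x i j n.+1 =
  tail_sum x i j n + (dig x (i + n.+1%:Z) j)%:R * 3^-1 ^+ n.+1.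
Proof. by rewrite /tail_sum big_ord_recr. Qed.

Lemma pow_third_gt0 n : (0 : R) < 3^-1 ^+ n.
Proof. by rewrite exprn_gt0// invr_gt0. Qed.

Lemma tail_sum_le x i j m n : (m <= n)%N ->
  tail_sum x i j m <= tail_sum x i j n
    <= tail_sum x i j m + 3 / 2 * (3^-1 ^+ m - 3^-1 ^+ n).
Proof.
move=> /subnK <-; elim: (n - m)%N => [|k /andP[IHl IHr]].
  by rewrite add0n subrr mulr0 addr0 lexx.
rewrite addSn tail_sumS.
have := pow_third_gt0 (k + m); rewrite exprS => pos.
have d3 : (dig x (i + (k + m).+1%:Z) j)%:R <= 3 :> R.
  by rewrite ler_nat -ltnS ltn_ord.
have d0 : 0 <= (dig x (i + (k + m).+1%:Z) j)%:R :> R by [].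
apply/andP; split; first by rewrite (le_trans IHl)// lerDl !mulr_ge0// ltW.
by nra.
Qed.

Lemma tail_approx x i j n :
  tail_sum x i j n <= tail x i j <= tail_sum x i j n + 3 / 2 * 3^-1 ^+ n.
Proof.
have ub m : tail_sum x i j m <= tail_sum x i j n + 3 / 2 * 3^-1 ^+ n.
  have [mn|/ltnW nm] := leqP m n.
    have /andP[h _] := tail_sum_le x i j mn; have := pow_third_gt0 n; lra.
  have /andP[_ h] := tail_sum_le x i j nm; have := pow_third_gt0 m; lra.
apply/andP; split; last first.
  by apply: ge_sup; [exists (tail_sum x i j 0), 0%N|move=> _ [m _ <-]].
apply: ub_le_sup; last by exists n.
by exists (tail_sum x i j n + 3 / 2 * 3^-1 ^+ n) => _ [m _ <-].
Qed.

Lemma pow_third_small (C e : R) : 0 < e -> exists n, C * 3^-1 ^+ n < e.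
Proof.
move=> e0; have : (fun n => C * 3^-1 ^+ n : R) @ \oo --> (0 : R).
  rewrite -[X in _ --> X](mulr0 C); apply: cvgMl_tmp; apply: cvg_expr.
  by rewrite ger0_norm ?invr_ge0// invf_lt1// ltr1n.
move=> /cvgrPdist_lt/(_ e e0)[n _ /(_ n (leqnn n))]; rewrite /= sub0r normrN.
by move=> /ltr_normlW h; exists n.
Qed.

Lemma eq_pow_third (a b C : R) : (forall n, `|a - b| <= C * 3^-1 ^+ n) -> a = b.
Proof.
move=> abC; apply/eqP; rewrite -subr_eq0; apply/negPn/negP => ab0.
have ab_gt0 : 0 < `|a - b| by rewrite normr_gt0.
by have [n] := pow_third_small C ab_gt0; rewrite ltNge abC.
Qed.

(** The carry rule telescopes along a row. *)
Lemma tail_sum_up x i j n : carry_set x ->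
  tail_sum x i j n - tail_sum x i (j + 1) n =
  ((car x i j)%:R - 1) - 3^-1 ^+ n * ((car x (i + n%:Z) j)%:R - 1).
Proof.
move=> /carry_setP xX; elim: n => [|n IHn].
  by rewrite !tail_sum0 expr0 addr0 mul1r !subrr.
have rule : (dig x (i + n%:Z + 1) j)%:R + (car x (i + n%:Z + 1) j)%:R + 2 =
    (dig x (i + n%:Z + 1) (j + 1))%:R + 3 * (car x (i + n%:Z) j)%:R :> R.
  by rewrite -natrM -!natrD xX.
have site : i + n%:Z + 1 = i + n.+1%:Z by rewrite -addrA [n%:Z + 1]addrC -intS.
rewrite site in rule.
have digE : (dig x (i + n.+1%:Z) j)%:R = (dig x (i + n.+1%:Z) (j + 1))%:R +
    3 * (car x (i + n%:Z) j)%:R - (car x (i + n.+1%:Z) j)%:R - 2 :> R.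
  by move: rule; lra.
move/eqP: IHn; rewrite subr_eq => /eqP sumE.
by rewrite !tail_sumS exprS digE sumE; field.
Qed.

(** Rows represent the same number modulo 1: the carries are the integers by
    which their expansions differ. *)
Lemma tail_up x i j : carry_set x ->
  tail x i j - tail x i (j + 1) = (car x i j)%:R - 1.
Proof.
move=> xX; apply: (@eq_pow_third _ _ 5) => n; have := pow_third_gt0 n.
have /andP[] := tail_approx x i j n; have /andP[] := tail_approx x i (j + 1) n.
have := tail_sum_up i j n xX.
have : (car x (i + n%:Z) j)%:R <= 2 :> R by rewrite ler_nat -ltnS ltn_ord.
have : 0 <= (car x (i + n%:Z) j)%:R :> R by [].
by move=> *; rewrite ler_norml; apply/andP; split; nra.
Qed.

Lemma tail_continuous : continuous (fun x : config sym => tail x 0 0).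
Proof.
move=> x.
apply: (@cvgrPdist_lt R R (config sym) (nbhs x) (nbhs_filter x) _ _).2 => e e0.
have [n ne] := pow_third_small (3 / 2) e0.
apply: (@filterS _ _ (nbhs_filter x) _ _ _ (agree_nbhs n x)) => y xy.
have eq_sum : tail_sum x 0 0 n = tail_sum y 0 0 n.
  apply: eq_bigr => k _; rewrite /dig xy//=.
  exact: ltn_ord.
have /andP[] := tail_approx x 0 0 n; have /andP[] := tail_approx y 0 0 n.
by rewrite eq_sum ltr_norml => *; apply/andP; split; lra.
Qed.

End tail.

Lemma act_val {R : realType} (t : Z2) (x : subshift_tds R carry_sft) :
  (set_val (tds_act t x) : config sym) = Defs.shift t (set_val x).
Proof. by []. Qed.

Definition one_config : config sym := fun=> (inord 1, inord 1).

Lemma carry_set_one : carry_set one_config.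
Proof. by move=> v; rewrite /carry_rule /= !inordK. Qed.

(** [cos (2 pi t)] forgets the integer part of the tail [t], so it takes the same
    value on all rows; it is not constant, since the constant digits 0 and 1 give
    the tails 0 and 1/2. *)
Lemma carry_sft_not_TCPE (R : realType) : ~ TCPE (subshift_tds R carry_sft).
Proof.
pose g (x : subshift_tds R carry_sft) : R :=
  cos (tail (set_val x : config sym) 0 0 * (pi *+ 2)).
apply: (@not_TCPE_vertical R (subshift_tds R carry_sft) g).
- pose f (x : subshift_tds R carry_sft) : config sym := set_val x.
  pose t (x : config sym) : R := tail x 0 0.
  pose c (r : R) : R := cos (r * (pi *+ 2)).
  have c_cont : continuous c.
    move=> r; apply: (@continuous_comp _ _ _ (fun r : R => r * (pi *+ 2)) cos).
      exact: mulrr_continuous.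
    exact: continuous_cos.
  have tf_cont : continuous (t \o f).
    move=> x; apply: (@continuous_comp _ _ _ f t x).
      exact: val_continuous.
    exact: tail_continuous.
  move=> x; apply: (@continuous_comp _ _ _ (t \o f) c x).
    exact: tf_cont.
  exact: c_cont.
- move=> i j x.
  have tailE k : tail (set_val (tds_act (i, k) x) : config sym) 0 0 =
      tail (set_val x : config sym) i k :> R.
    rewrite /tail; suff -> : @tail_sum R (set_val (tds_act (i, k) x)) 0 0 =
      tail_sum (set_val x) i k by [].
    apply/funext => n; apply: eq_bigr => l _.
    rewrite act_val /dig /Defs.shift.
    have -> // : (0 + l.+1%:Z, 0) + (i, k) = (i + l.+1%:Z, k) :> Z2.
    by apply: injective_projections; rewrite /= ?add0r// addrC.
  rewrite /g !tailE.
  have xX : carry_set (set_val x) by exact: set_valP.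
  have step k : cos (tail (set_val x : config sym) i k * (pi *+ 2)) =
      cos (tail (set_val x : config sym) i (k + 1) * (pi *+ 2)) :> R.
    have := @tail_up R _ i k xX.
    have : (car (set_val x : config sym) i k < 3)%N by exact: ltn_ord.
    case: (car _ i k) => [|[|[|//]]] _ /eqP; rewrite subr_eq => /eqP ->.
    + by rewrite -[LHS](@cosD2pi R); congr cos; ring.
    + by congr cos; ring.
    + by rewrite -[RHS](@cosD2pi R); congr cos; ring.
  elim/int_rec: j => // n IHn.
    by rewrite intS addrC -step.
  by rewrite step -addn1 PoszD opprD addrNK.
- exists (SigSub (mem_set carry_set_zero)), (SigSub (mem_set carry_set_one)).
  rewrite /g /=.
  have -> : tail zero_config 0 0 = 0 :> R.
    apply: (@eq_pow_third _ _ _ (3 / 2)) => n.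
    have /andP[] := @tail_approx R zero_config 0 0 n.
    have -> : tail_sum zero_config 0 0 n = 0 :> R.
      by rewrite /tail_sum big1// => k _; rewrite /dig /= mul0r.
    by have := @pow_third_gt0 R n => *; rewrite ler_norml; apply/andP; split; lra.
  have -> : tail one_config 0 0 = 1 / 2 :> R.
    apply: (@eq_pow_third _ _ _ 2) => n.
    have /andP[] := @tail_approx R one_config 0 0 n.
    have -> : tail_sum one_config 0 0 n = (1 - 3^-1 ^+ n) / 2 :> R.
      elim: n => [|n IHn]; first by rewrite tail_sum0 expr0 subrr mul0r.
      by rewrite tail_sumS IHn /dig /= inordK// exprS; lra.
    by have := @pow_third_gt0 R n => *; rewrite ler_norml; apply/andP; split; lra.
  have -> : 1 / 2 * (pi *+ 2) = pi :> R by lra.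
  by rewrite mul0r cos0 cospi; lra.
Qed.

(** * Words of equal value *)

(** [b p] is the number with the first [p] digits of a word of [L] digits in
    {0, 1, 2, 3}, so the word has value [V]. *)
Definition block (L V : nat) (b : nat -> nat) : Prop :=
  [/\ b 0 = 0, b L = V &
    forall p, (p < L)%N -> (3 * b p <= b p.+1 <= 3 * b p + 3)%N].

(** A gap of 2 between two words at some prefix would be multiplied by 3 and
    reduced by at most 3 at each later digit: it could not close again. *)
Lemma block_close L V b b' p : block L V b -> block L V b' -> (p <= L)%N ->
  (b p <= b' p + 1)%N.
Proof.
move=> [_ bL b3] [_ b'L b'3] /subnK; move: (L - p)%N => k.
elim: k p => [|k IHk] p kp; first by rewrite add0n in kp; subst p; lia.
have pL : (p < L)%N by lia.
by have := IHk p.+1 ltac:(lia); have := b3 p pL; have := b'3 p pL; lia.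
Qed.

(** Some word of value [V + 1] ends in a nonzero digit; decreasing this digit
    gives a word of value [V] with the same proper prefixes. *)
Lemma block_pred L V b : block L V.+1 b -> exists b1 b2,
  [/\ block L V b1, block L V.+1 b2 & forall p, (p < L)%N -> b1 p = b2 p].
Proof.
elim: L V b => [|L IHL] V b [b0 bL b3]; first by rewrite b0 in bL.
have bLb : block L (b L) b by split=> // p pL; apply: b3; lia.
pose ext c U p := if p == L.+1 then U else (c p : nat).
have extP c W U : block L W c -> (3 * W <= U <= 3 * W + 3)%N ->
    block L.+1 U (ext c U).
  move=> [c0 cL c3] WU; rewrite /ext; split=> //; first by rewrite eqxx.
  move=> p; rewrite ltnS leq_eqVlt => /orP[/eqP ->|pL].
    by rewrite eqxx ltn_eqF// cL.
  have -> : (p == L.+1) = false by apply/eqP; lia.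
  have -> : (p.+1 == L.+1) = false by apply/eqP; lia.
  exact: c3.
have ext_eq c U U' p : (p < L.+1)%N -> ext c U p = ext c U' p.
  by move=> pL; rewrite /ext ltn_eqF.
have := b3 L (ltnSn L); rewrite bL => b3L.
have [E|ne] := eqVneq V.+1 (3 * b L)%N; last first.
  exists (ext b V), (ext b V.+1); split=> [||p pL]; last exact: ext_eq.
    by apply: extP bLb _; lia.
  by apply: extP bLb _; lia.
(* A final digit 0 borrows from the digits before it and becomes 3. *)
have [W WE] : exists W, b L = W.+1 by exists (b L).-1; lia.
rewrite WE in bLb; have [c1 [c2 [c1W _ _]]] := IHL W b bLb.
exists (ext c1 V), (ext c1 V.+1); split=> [||p pL]; last exact: ext_eq.
  by apply: extP c1W _; lia.
by apply: extP c1W _; lia.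
Qed.

Section block_config.
Variables (L : nat) (L_gt0 : (0 < L)%N).
Implicit Type w : int -> int -> nat -> nat.

(** The word [w k j] fills the columns [k * L], ..., [k * L + L - 1] of row [j].
    The carry at a site is the difference of the prefix values of the two rows,
    so it vanishes at the end of a block when all words have the same value, and
    the blocks can be chosen independently of each other. *)
Definition block_config w : config sym := fun v =>
  let k := (v.1 %/ L)%Z in let p := `|(v.1 %% L)%Z|%N in
  (inord (w k v.2 p.+1 - 3 * w k v.2 p),
   inord (w k (v.2 + 1) p.+1 + 1 - w k v.2 p.+1)).

Lemma divz_block (k : int) (p : nat) : (p < L)%N -> ((p%:Z + k * L%:Z) %/ L)%Z = k.
Proof. by move=> pL; rewrite divzDr ?dvdz_mull// mulzK ?divz_small; lia. Qed.

Lemma modz_block (k : int) (p : nat) : (p < L)%N -> `|((p%:Z + k * L%:Z) %% L)%Z|%N = p.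
Proof. by move=> pL; rewrite addrC modzMDl modz_small; lia. Qed.

Lemma block_configE w (k j : int) (p : nat) : (p < L)%N ->
  block_config w (p%:Z + k * L%:Z, j) =
  (inord (w k j p.+1 - 3 * w k j p), inord (w k (j + 1) p.+1 + 1 - w k j p.+1)).
Proof. by move=> pL; rewrite /block_config /= divz_block ?modz_block. Qed.

Lemma block_coord (i : int) : exists (k : int) (p : nat),
  (p < L)%N /\ i = p%:Z + k * L%:Z.
Proof.
exists (i %/ L)%Z, `|(i %% L)%Z|%N.
have L_neq0 : L%:Z != 0 by lia.
have Lz_gt0 : 0 < L%:Z by lia.
have := divz_eq i L; have := modz_ge0 i L_neq0; have := ltz_pmod i Lz_gt0.
by split; lia.
Qed.

Section config_blocks.
Variables (V : nat) (w : int -> int -> nat -> nat).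
Hypothesis w_block : forall k j, block L V (w k j).

Lemma dig_block_config (k j : int) p : (p < L)%N ->
  dig (block_config w) (p%:Z + k * L%:Z) j = (w k j p.+1 - 3 * w k j p)%N.
Proof.
move=> pL; rewrite /dig block_configE//= inordK//.
by have [_ _ /(_ p pL)] := w_block k j; lia.
Qed.

Lemma car_block_config (k j : int) p : (p < L)%N ->
  car (block_config w) (p%:Z + k * L%:Z) j = (w k (j + 1) p.+1 + 1 - w k j p.+1)%N.
Proof.
move=> pL; rewrite /car block_configE//= inordK//.
by have := block_close (w_block k j) (w_block k (j + 1)) pL;
   have := block_close (w_block k (j + 1)) (w_block k j) pL; lia.
Qed.

Lemma carry_set_block_config : carry_set (block_config w).
Proof.
apply/carry_setP => i j; have [k [p [pL iE]]] := block_coord (i + 1).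
have car_prev : car (block_config w) i j = (w k (j + 1) p + 1 - w k j p)%N.
  case: p pL iE => [|p] pL iE.
    have -> : i = L.-1%:Z + (k - 1) * L%:Z by lia.
    rewrite car_block_config ?prednK//.
    have [-> _ _] := w_block k j; have [-> _ _] := w_block k (j + 1).
    have [_ -> _] := w_block (k - 1) j; have [_ -> _] := w_block (k - 1) (j + 1).
    by lia.
  have -> : i = p%:Z + k * L%:Z by lia.
  by rewrite car_block_config// ltnW.
rewrite car_prev iE !dig_block_config// car_block_config//.
have [_ _ /(_ p pL)] := w_block k j; have [_ _ /(_ p pL)] := w_block k (j + 1).
have close q := block_close (w_block k j) (w_block k (j + 1)) (p := q).
have close' q := block_close (w_block k (j + 1)) (w_block k j) (p := q).
have := close p (ltnW pL); have := close' p (ltnW pL).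
have := close p.+1 pL; have := close' p.+1 pL.
lia.
Qed.

End config_blocks.
End block_config.

Section rows.
Variable x : config sym.
Hypothesis xX : carry_set x.

(** Up to the shift by [q], the carry between rows [j] and [j + q]. *)
Definition carry_sum (i j : int) (q : nat) : nat :=
  (\sum_(k < q) car x i (j + k%:Z))%N.

Lemma carry_sumS i j q : carry_sum i j q.+1 = (carry_sum i j q + car x i (j + q%:Z))%N.
Proof. by rewrite /carry_sum big_ord_recr. Qed.

Lemma carry_sum0 i j : carry_sum i j 0 = 0%N.
Proof. by rewrite /carry_sum big_ord0. Qed.

Lemma carry_sumD i j q r :
  carry_sum i j (q + r) = (carry_sum i j q + carry_sum i (j + q%:Z) r)%N.
Proof.
elim: r => [|r IHr]; first by rewrite addn0 carry_sum0 addn0.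
by rewrite addnS !carry_sumS IHr addnA PoszD addrA.
Qed.

Lemma dig_le3 i j : (dig x i j <= 3)%N.
Proof. by rewrite -ltnS ltn_ord. Qed.

Lemma car_le2 i j : (car x i j <= 2)%N.
Proof. by rewrite -ltnS ltn_ord. Qed.

Lemma carry_sum_rule i j q :
  (dig x (i + 1) j + carry_sum (i + 1) j q + 2 * q =
   dig x (i + 1) (j + q%:Z) + 3 * carry_sum i j q)%N.
Proof.
elim: q => [|q IHq]; first by rewrite !carry_sum0 addr0; lia.
rewrite !carry_sumS; move/carry_setP: xX => /(_ i (j + q%:Z)).
rewrite -addrA [q%:Z + 1]addrC -intS; move: IHq.
move: (dig x (i + 1) j) (dig x (i + 1) (j + q%:Z)) (dig x _ (j + q.+1%:Z)).
move: (car x _ _) (car x _ _) (carry_sum _ _ _) (carry_sum _ _ _).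
lia.
Qed.

Lemma carry_sum_next i j q m :
  (carry_sum (i + m.+1%:Z) j q + 2 * q <= 3 * carry_sum (i + m%:Z) j q + 3 /\
   3 * carry_sum (i + m%:Z) j q <= carry_sum (i + m.+1%:Z) j q + 2 * q + 3)%N.
Proof.
have := carry_sum_rule (i + m%:Z) j q; rewrite -addrA [m%:Z + 1]addrC -intS.
have := dig_le3 (i + m.+1%:Z) j; have := dig_le3 (i + m.+1%:Z) (j + q%:Z).
move: (dig x _ j) (dig x _ _) (carry_sum _ _ _) (carry_sum _ _ _); lia.
Qed.

Lemma carry_sum_le i j q : (carry_sum i j q <= 2 * q)%N.
Proof.
elim: q => [|q IHq]; first by rewrite carry_sum0.
by rewrite carry_sumS; have := car_le2 i (j + q%:Z); lia.
Qed.

(** The carry between any two rows stays in {-1, 0, 1}: beyond these values the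
    carry rule would make it grow without bound to the right, while the sum of
    [q] carries is bounded. *)
Lemma carry_sum_bound i j q : (q <= carry_sum i j q + 1)%N /\ (carry_sum i j q <= q + 1)%N.
Proof.
split; rewrite leqNgt; apply/negP => H.
  have grow m : (carry_sum (i + m%:Z) j q + 2 + m <= q)%N.
    elim: m => [|m]; first by rewrite addr0; move: H; lia.
    have [+ _] := carry_sum_next i j q m.
    by move: (carry_sum _ _ _) (carry_sum _ _ _); lia.
  by have := grow q; lia.
have grow m : (q + 2 + m <= carry_sum (i + m%:Z) j q)%N.
  elim: m => [|m]; first by rewrite addr0; move: H; lia.
  have [_ +] := carry_sum_next i j q m.
  by move: (carry_sum _ _ _) (carry_sum _ _ _); lia.
have := grow q; have := carry_sum_le (i + q%:Z) j q.
by move: (carry_sum _ _ _); lia.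
Qed.

(** The prefix values of row [q] of [x] from column 0 on, started after one extra
    digit that compensates for the carry entering column 0: the value 1 for row
    0, corrected by the carry between rows 0 and [q]. *)
Fixpoint row_value (q p : nat) : nat :=
  if p is p'.+1 then 3 * row_value q p' + dig x p' q
  else (1 + carry_sum (-1) 0 q - q)%N.

Lemma row_valueE q p :
  (row_value q p + q = row_value 0 p + carry_sum (p%:Z - 1) 0 q)%N.
Proof.
elim: p => [|p IHp] /=.
  rewrite carry_sum0 sub0r; have [] := carry_sum_bound (-1) 0 q.
  by move: (carry_sum _ _ _); lia.
have := carry_sum_rule (p%:Z - 1) 0 q; rewrite subrK add0r.
rewrite intS [1 + _]addrC addrK; move: IHp; move: (row_value q p) (row_value 0 p).
by move: (carry_sum _ _ _) (carry_sum _ _ _) (dig x _ _) (dig x _ _); lia.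
Qed.

Lemma row_value_close q q' p : (row_value q p <= row_value q' p + 1)%N.
Proof.
have := row_valueE q p; have := row_valueE q' p.
move: (row_value q p) (row_value q' p) (row_value 0 p).
have [le_qq|/ltnW le_qq] := leqP q q'; move: (subnKC le_qq) => qqE.
  have := carry_sumD (p%:Z - 1) 0 q (q' - q); rewrite qqE.
  have [] := carry_sum_bound (p%:Z - 1) (0 + q%:Z) (q' - q).
  by move: (carry_sum _ _ _) (carry_sum _ _ _) (carry_sum _ _ _); lia.
have := carry_sumD (p%:Z - 1) 0 q' (q - q'); rewrite qqE.
have [] := carry_sum_bound (p%:Z - 1) (0 + q'%:Z) (q - q').
by move: (carry_sum _ _ _) (carry_sum _ _ _) (carry_sum _ _ _); lia.
Qed.

(** One more digit on each side of the window turns row [q] into a block. *)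
Definition row_block (N V q p : nat) : nat :=
  if p is p'.+1 then if (p' <= N)%N then row_value q p' else V else 0%N.

(** At the right end of the window the prefix values of the rows take at most two
    consecutive values [m] and [m + 1]; a final digit, at most 3 or 0
    respectively, brings all of them to [3 * (m + 1)]. *)
Lemma row_blockP N : exists V, forall q, block N.+2 V (row_block N V q).
Proof.
have [m [[q0 q0m] mP]] : exists m, (exists q, row_value q N = m) /\
    forall q, (m <= row_value q N)%N.
  have [|m /asboolP mE mP] := @ex_minnP (fun m => `[< exists q, row_value q N = m >]).
    by exists (row_value 0 N); apply/asboolP; exists 0%N.
  by exists m; split=> // q; apply: mP; apply/asboolP; exists q.
exists (3 * m.+1)%N => q; split=> //=; first by rewrite ltnn.
case=> [|p] /=.
  by move=> _; have [] := carry_sum_bound (-1) 0 q; move: (carry_sum _ _ _); lia.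
rewrite !ltnS => pN; rewrite pN; have [pN'|Np] := leqP p.+1 N.
  by have := dig_le3 p q; move: (dig x _ _); lia.
have -> : p = N by lia.
by have := mP q; have := row_value_close q q0 N; lia.
Qed.

(** Every pattern of [x] in a square thus occurs in an arrangement of blocks of
    the same value. *)
Lemma row_block_window N V (w : int -> int -> nat -> nat) (i j : nat) :
  (forall q : nat, (q <= N)%N -> w 0 q = row_block N V q) -> (i < N)%N -> (j < N)%N ->
  block_config N.+2 w (i.+1%:Z, j%:Z) = x (i%:Z, j%:Z).
Proof.
move=> wE iN jN.
have := @block_configE N.+2 isT w 0 j i.+1; rewrite mul0r addr0 => -> //; last by lia.
have -> : j%:Z + 1 = j.+1%:Z by rewrite intS addrC.
rewrite !wE ?(ltnW jN)// /row_block (ltnW iN) iN.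
have vE : row_value j i.+1 = (3 * row_value j i + dig x i j)%N by [].
move: vE (row_value_close j j.+1 i.+1) (row_value_close j.+1 j i.+1).
move: (row_valueE j.+1 i.+1) (row_valueE j i.+1).
rewrite carry_sumS intS [1 + _]addrC addrK add0r.
move: (row_value j.+1 i.+1) (row_value j i.+1) (row_value 0 i.+1) => u v v0.
move: (carry_sum _ _ _) (dig_le3 i j) (car_le2 i j) => c d3 c2 uE vE' vE vu uv.
apply: injective_projections; apply: val_inj; rewrite /= -/(dig x i j) -/(car x i j).
  by rewrite vE addKn inordK.
by rewrite inordK; move: uE vE' vu uv c2; move: (car x i j); lia.
Qed.

End rows.

(** * Predicates that ignore exchanges of words of equal value *)

Definition right : Z2 := (1, 0).

Lemma shift_right (x : config sym) (i j : int) :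
  Defs.shift right x (i, j) = x (i + 1, j).
Proof.
by rewrite /Defs.shift; congr x; apply: injective_projections; rewrite /= ?addr0.
Qed.

(** The same [L] rows of one block each, repeated in both directions. *)
Definition family_config (L : nat) (f : nat -> nat -> nat) : config sym :=
  block_config L (fun _ j => f `|(j %% L)%Z|%N).

Definition local_on (N : nat) (P : config sym -> Prop) :=
  forall x y, carry_set x -> carry_set y ->
  (forall i j : nat, (i < N)%N -> (j < N)%N -> x (i%:Z, j%:Z) = y (i%:Z, j%:Z)) ->
  P x -> P y.

Section connect.
Variables (N : nat) (P : config sym -> Prop).
Hypothesis P_local : local_on N P.
Let L := N.+2.
Let Pf f := P (Defs.shift right (family_config L f)).

Lemma family_config_carry V f :
  (forall q, block L V (f q)) -> carry_set (Defs.shift right (family_config L f)).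
Proof.
by move=> fV; apply: carry_set_invariant; apply: (@carry_set_block_config L isT V).
Qed.

(** After the shift, the window sees the first [L - 1] digits at most of each
    block. *)
Lemma family_config_window V V' f f' :
  (forall q, block L V (f q)) -> (forall q, block L V' (f' q)) ->
  (forall q p, (p < L)%N -> f q p = f' q p) -> Pf f -> Pf f'.
Proof.
move=> fV fV' ff'; apply: P_local.
- exact: family_config_carry fV.
- exact: family_config_carry fV'.
move=> i j iN jN; rewrite !shift_right.
have -> : i%:Z + 1 = i.+1%:Z + 0 * L%:Z by rewrite mul0r addr0 intS addrC.
rewrite /family_config !block_configE//; [|lia..].
by rewrite !ff'//; rewrite /L /=; lia.
Qed.

Hypothesis P_flexible : forall V f f',
  (forall q, block L V (f q)) -> (forall q, block L V (f' q)) -> Pf f -> Pf f'.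

(** The value [V] is lowered one unit at a time: the constant family with value
    [V + 1] given by [block_pred] looks in the window like one with value [V]. *)
Lemma flexible_family_zero V f : (forall q, block L V (f q)) ->
  (Pf f <-> Pf (fun _ _ => 0%N)).
Proof.
have zero_block (q : nat) : block L 0 (fun=> 0%N) by split.
elim: V f => [|V IHV] f fV; first by split; apply: (P_flexible (V := 0)).
have [b1 [b2 [b1V b2V b12]]] := block_pred (fV 0%N).
have step : Pf (fun=> b2) <-> Pf (fun=> b1).
  by split; [apply: (@family_config_window V.+1 V)|apply: (@family_config_window V V.+1)];
    move=> // q p pL; rewrite b12// /L; lia.
rewrite -(IHV (fun=> b1)) => // ; rewrite -step.
by split; apply: (P_flexible (V := V.+1)).
Qed.

Lemma flexible_constant x y : carry_set x -> carry_set y -> P x -> P y.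
Proof.
have to_zero z : carry_set z -> (P z <-> Pf (fun _ _ => 0%N)).
  move=> zX; have [V zV] := row_blockP zX N.
  rewrite -(flexible_family_zero zV).
  have window i j : (i < N)%N -> (j < N)%N ->
      Defs.shift right (family_config L (row_block z N V)) (i%:Z, j%:Z) = z (i%:Z, j%:Z).
    move=> iN jN; rewrite shift_right.
    have -> : i%:Z + 1 = i.+1%:Z by rewrite intS addrC.
    apply: (row_block_window zX (V := V)) => // q qN.
    by rewrite modz_small ?absz_nat// ; lia.
  by split; apply: P_local => //; try exact: family_config_carry zV;
    move=> i j iN jN; rewrite window.
by move=> /to_zero -> /to_zero ->.
Qed.

End connect.

(** * Factors of positive entropy *)

Lemma clopen_open_cover (T : topologicalType) (B : set T) :
  clopen B -> open_cover [set B; ~` B].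
Proof.
move=> [oB cB]; split; first by move=> _ [|] ->; rewrite ?openC.
rewrite -subTset => y _; have [By|nBy] := pselect (B y).
  by exists B => //; left.
by exists (~` B) => //; right.
Qed.

Section factor.
Context {R : realType} (Y : Z2tds R) (phi : subshift_tds R carry_sft -> Y).
Hypothesis phi_factor : factor_map phi.

Definition carry_point (z : config sym) (zX : carry_set z) : subshift_tds R carry_sft :=
  SigSub (mem_set zX).

(** Defined on all configurations, so that windows and arrangements of blocks can
    be compared without membership proofs. *)
Definition coded_in (B : set Y) (z : config sym) : Prop :=
  exists zX : carry_set z, B (phi (carry_point zX)).

Lemma coded_in_point B z (zX : carry_set z) : coded_in B z <-> B (phi (carry_point zX)).
Proof.
by split=> [[zX']|Bz]; [rewrite (Prop_irrelevance zX' zX)|exists zX].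
Qed.

Lemma coded_in_shift B z (zX : carry_set z) t :
  coded_in B (Defs.shift t z) <-> B (tds_act t (phi (carry_point zX))).
Proof.
rewrite (coded_in_point _ (carry_set_invariant t zX)) -(phi_factor.2 t).
suff -> : carry_point (carry_set_invariant t zX) = tds_act t (carry_point zX) by [].
exact: val_inj.
Qed.

Section mosaic.
Variables (N V : nat) (B : set Y) (f f' : nat -> nat -> nat).
Let L := N.+2.
Hypothesis B_clopen : clopen B.
Hypothesis B_local : local_on N (coded_in B).
Hypothesis f_block : forall q, block L V (f q).
Hypothesis f'_block : forall q, block L V (f' q).
Hypothesis Bf : coded_in B (Defs.shift right (family_config L f)).
Hypothesis nBf' : ~ coded_in B (Defs.shift right (family_config L f')).

Section square.
Variable K : nat.

(** The squares of side [L] are filled with [f] or [f'] according to [S]. They lie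
    in the quadrant of negative columns and rows because [tds_act v @` B] asks
    about the point translated by [- v], for [v] in a box of positive
    coordinates. *)
Definition mosaic (S : {ffun 'I_K.+1 * 'I_K.+1 -> bool}) : config sym :=
  block_config L (fun k j =>
    (if S (inord (`|k|%N).-1, inord (`|(j %/ L)%Z|%N).-1) then f else f') `|(j %% L)%Z|%N).

Lemma mosaic_carry S : carry_set (mosaic S).
Proof. by apply: (@carry_set_block_config L isT V) => k j; case: ifP. Qed.

(** The point of the box that brings the window of [B], shifted by one column
    inside a block, into the square with index [ab]. *)
Definition square_offset (ab : 'I_K.+1 * 'I_K.+1) : Z2 :=
  ((ab.1.+1 * L)%N%:Z - 1, (ab.2.+1 * L)%N%:Z).

Lemma mosaic_square S ab :
  coded_in B (Defs.shift (- square_offset ab) (mosaic S)) <-> S ab.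
Proof.
have window g : (if S ab then f else f') = g ->
    forall i j : nat, (i < N)%N -> (j < N)%N ->
    Defs.shift (- square_offset ab) (mosaic S) (i%:Z, j%:Z) =
    Defs.shift right (family_config L g) (i%:Z, j%:Z).
  move=> Sg i j iN jN; rewrite shift_right.
  have -> : i%:Z + 1 = i.+1%:Z + 0 * L%:Z by rewrite mul0r addr0 intS addrC.
  rewrite /Defs.shift.
  have -> : (i%:Z, j%:Z) - square_offset ab =
      (i.+1%:Z + - ab.1.+1%:Z * L%:Z, j%:Z + - ab.2.+1%:Z * L%:Z).
    by apply: injective_projections; rewrite /= ?PoszM; lia.
  have row (q : nat) : (q < L)%N ->
      (`|((q%:Z + - ab.2.+1%:Z * L%:Z) %% L)%Z|%N = q) /\
      ((q%:Z + - ab.2.+1%:Z * L%:Z) %/ L)%Z = - ab.2.+1%:Z.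
    by move=> qL; rewrite (@modz_block L) ?(@divz_block L).
  have [jL jL'] : (j < L)%N /\ (j.+1 < L)%N by rewrite /L; lia.
  have iL : (i.+1 < L)%N by rewrite /L; lia.
  rewrite /mosaic /family_config !(@block_configE L isT)//.
  have -> : j%:Z + - ab.2.+1%:Z * L%:Z + 1 = j.+1%:Z + - ab.2.+1%:Z * L%:Z by lia.
  have -> : j%:Z + 1 = j.+1%:Z by rewrite intS addrC.
  have [-> ->] := row _ jL; have [-> ->] := row _ jL'.
  rewrite !modz_small ?absz_nat//.
  have -> : (inord (`|- ab.1.+1%:Z|%N).-1, inord (`|- ab.2.+1%:Z|%N).-1) = ab.
    by rewrite !abszN !absz_nat /= !inord_val; case: (ab).
  by rewrite Sg.
have mX := carry_set_invariant (- square_offset ab) (mosaic_carry S).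
have fX g : (forall q, block L V (g q)) -> carry_set (Defs.shift right (family_config L g)).
  exact: family_config_carry.
case: (boolP (S ab)) window => Sab window; split=> //.
  move=> _; apply: B_local Bf => // [|i j iN jN]; first exact: fX.
  by rewrite (window f).
move=> Bm; case: nBf'; apply: B_local Bm => // [|i j iN jN]; first exact: fX.
by rewrite (window f').
Qed.

Lemma mosaic_card n : (K.+1 * L <= n)%N ->
  (2 ^ K.+1 ^ 2)%:R <= join_card [set B; ~` B] n :> R.
Proof.
move=> Kn.
have -> : (2 ^ K.+1 ^ 2)%N = #|{: {ffun 'I_K.+1 * 'I_K.+1 -> bool}}|.
  by rewrite card_ffun card_bool card_prod card_ord mulnn.
have oU := clopen_open_cover B_clopen.
have [K0 cov] := coverable_box n oU.
apply: (@subcover_card_ge R Y _ (fun S => phi (carry_point (mosaic_carry S))) _ _ cov).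
move=> D S S' [E EU <-] yS yS'; apply/ffunP => ab.
have ab_box : box n (square_offset ab).
  have := ltn_ord ab.1; have := ltn_ord ab.2; rewrite /box /= /L => h1 h2.
  by apply/andP; split; nia.
have [G UG GE] := EU _ ab_box.
have inG T : (\bigcap_(v in box n) E v) (phi (carry_point (mosaic_carry T))) ->
    G (tds_act (- square_offset ab) (phi (carry_point (mosaic_carry T)))).
  by move=> /(_ _ ab_box); rewrite -GE => -[z Gz <-]; rewrite tds_actNK.
have square T := iff_trans (iff_sym (mosaic_square T ab))
  (coded_in_shift B (mosaic_carry T) (- square_offset ab)).
move/inG: yS; move/inG: yS'; case: UG => ->.
  by move=> /square -> /square ->.
by move=> nS' nS; apply/idP/idP => /square.
Qed.

End square.

(** Two families of the same value that [B] distinguishes can be exchanged freely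
    in each square: the factor has positive entropy. *)
Lemma mosaic_entropy : (0 < entropy Y)%E.
Proof.
have oU := clopen_open_cover B_clopen.
have y0 : Y := phi (carry_point carry_set_zero).
apply: (@entropy_gt0 R Y [set B; ~` B] L _ oU) => //; first by exists y0.
move=> n; case E : (n %/ L)%N => [|K].
  rewrite exp0n// expn0; have [K0 cov] := coverable_box n oU.
  by apply: subcover_card_ge1 cov; constructor.
by apply: mosaic_card; rewrite -E leq_divM.
Qed.

End mosaic.
End factor.

(** In a factor of zero entropy, a clopen set cannot distinguish families of the
    same value, so it is empty or full. *)
Lemma carry_sft_ZTCPE (R : realType) : ZTCPE (subshift_tds R carry_sft).
Proof.
move=> Y phi [Bs clB [oB basisB]] phi_factor phi_surj.
have [[y0 Y1]|nY1] := pselect (exists y : Y, [set: Y] = [set y]); first by right; exists y0.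
left; apply: contrapT => nent.
pose y0 : Y := phi (carry_point carry_set_zero).
have [y1 y10] : exists y1, y1 <> y0.
  apply: contrapT => nex; apply: nY1; exists y0.
  apply/seteqP; split=> // y _ /=; apply: contrapT => yy0.
  by apply: nex; exists y.
have y0_nbhs : nbhs y0 (~` [set y1]).
  apply: open_nbhs_nbhs; split; last by move=> /= /esym.
  by rewrite openC; apply: accessible_closed_set1; apply: hausdorff_accessible;
    exact: metric_hausdorff.
have [B [BBs By0] nBy1] := basisB y0 _ y0_nbhs.
have clopenB : clopen B by exact: clB.
have [n nB] : exists n, forall x y : subshift_tds R carry_sft,
    agree n (set_val x) (set_val y) -> (phi @^-1` B) x -> (phi @^-1` B) y.
  apply: clopen_local; apply: preimage_clopen => //.
  exact: phi_factor.1.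
(* Translating B makes the window of phi @^-1` C the square [0, 2n]^2. *)
pose t : Z2 := (n%:Z, n%:Z).
pose C : set Y := tds_act t @^-1` B.
have clopenC : clopen C by apply: preimage_clopen => //; exact: tds_act_continuous.
have localC : local_on (2 * n).+1 (coded_in phi C).
  move=> x y xX yX xy; rewrite !(coded_in_point _ _ xX) !(coded_in_point _ _ yX).
  rewrite /C /= -!(phi_factor.2 t); apply: nB => -[v1 v2] /= v1n v2n.
  change (x ((v1, v2) + t) = y ((v1, v2) + t)).
  have -> : (v1, v2) + t = ((absz (v1 + n%:Z)%R)%:Z, (absz (v2 + n%:Z)%R)%:Z).
    by apply: injective_projections; rewrite /=; lia.
  by apply: xy; lia.
have flex V f f' : (forall q, block (2 * n).+3 V (f q)) ->
    (forall q, block (2 * n).+3 V (f' q)) ->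
    coded_in phi C (Defs.shift right (family_config (2 * n).+3 f)) ->
    coded_in phi C (Defs.shift right (family_config (2 * n).+3 f')).
  move=> fV f'V Cf; apply: contrapT => nCf'; apply: nent.
  exact: (mosaic_entropy phi_factor clopenC localC fV f'V Cf nCf').
have C_full y : C y.
  have [x _ xy] : range phi y by rewrite phi_surj.
  have [z _ zy0] : range phi (tds_act (- t) y0) by rewrite phi_surj.
  have xP (u : subshift_tds R carry_sft) :
      exists (w : config sym) (wX : carry_set w), u = carry_point wX.
    by exists (set_val u), (set_valP u); exact: val_inj.
  have [wx [wxX xE]] := xP x; have [wz [wzX zE]] := xP z.
  rewrite -xy xE -(coded_in_point phi C wxX).
  apply: (flexible_constant localC flex wzX wxX).
  by rewrite (coded_in_point phi C wzX) -zE zy0 /C /= tds_actKN.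
by apply: (nBy1 y1) => //; have := C_full (tds_act (- t) y1); rewrite /C /= tds_actKN.
Qed.

Theorem theorem1p5 (R : realType) :
  exists (A : finType) (X : subshift A),
    is_sft X /\ ZTCPE (subshift_tds R X) /\ ~ TCPE (subshift_tds R X).
Proof.
exists sym, carry_sft; split; first exact: carry_sft_is_sft.
by split; [exact: carry_sft_ZTCPE|exact: carry_sft_not_TCPE].
Qed.
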